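(* Let $\mathbb{F}$ be a field of characteristic zero. Suppose that $g(x) = g_0 + g_rx^r + g_{r+1}x^{r+1} + \cdots \in \mathbb{F}[[x]]$ with $r \geq 1$ and $g_r \neq 0$. Let $a(x) = a_sx^s + a_{s+1}x^{s+1} + \cdots$ and $b(x) = b_sx^s + b_{s+1}x^{s+1} + \cdots$ be elements of $\mathbb{F}[[x]]$, where $s \geq 1$ and $a_s = b_s \neq 0$. Then $$g\big(a(x)\big) = g\big(b(x)\big) \implies a(x) = b(x).$$
   Context: $\mathbb{F}[[x]]$ is the ring of formal power series over $\mathbb{F}$. There is no assumption that $g(x)$ has a compositional inverse. *)

(* Defs.v *)
From HB Require Import structures.
From mathcomp Require Import all_boot all_algebra.
From mathcomp Require Import boolp.
Set Implicit Arguments.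
Unset Strict Implicit.
Unset Printing Implicit Defensive.
Import GRing.Theory.
Local Open Scope ring_scope.

(* A record rather than an alias of [nat -> R], so that the Cauchy product does
   not clash with the pointwise product that MathComp-Analysis puts on
   functions. *)
Record fps (R : comNzRingType) := Fps { fps_coef :> nat -> R }.

Notation "{ 'fps' R }" := (fps R) (at level 0, format "{ 'fps'  R }")
  : type_scope.

Lemma fpsP (R : comNzRingType) (a b : {fps R}) : (forall n, a n = b n) -> a = b.
Proof. by case: a b => [a] [b] /= /funext ->. Qed.

HB.instance Definition _ (R : comNzRingType) := gen_eqMixin {fps R}.
HB.instance Definition _ (R : comNzRingType) := gen_choiceMixin {fps R}.

Definition fps_zero (R : comNzRingType) : {fps R} := Fps (fun=> 0).
Definition fps_one (R : comNzRingType) : {fps R} := Fps (fun n => (n == 0%N)%:R).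
Definition fps_opp (R : comNzRingType) (a : {fps R}) : {fps R} :=
  Fps (fun n => - a n).
Definition fps_add (R : comNzRingType) (a b : {fps R}) : {fps R} :=
  Fps (fun n => a n + b n).
Definition fps_mul (R : comNzRingType) (a b : {fps R}) : {fps R} :=
  Fps (fun n => \sum_(j < n.+1) a j * b (n - j)%N).

Lemma fps_addA (R : comNzRingType) : associative (@fps_add R).
Proof. by move=> a b c; apply: fpsP => n /=; rewrite addrA. Qed.
Lemma fps_addC (R : comNzRingType) : commutative (@fps_add R).
Proof. by move=> a b; apply: fpsP => n /=; rewrite addrC. Qed.
Lemma fps_add0 (R : comNzRingType) : left_id (@fps_zero R) (@fps_add R).
Proof. by move=> a; apply: fpsP => n /=; rewrite add0r. Qed.
Lemma fps_addN (R : comNzRingType) :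
  left_inverse (@fps_zero R) (@fps_opp R) (@fps_add R).
Proof. by move=> a; apply: fpsP => n /=; rewrite addNr. Qed.

HB.instance Definition _ (R : comNzRingType) :=
  GRing.isZmodule.Build {fps R}
    (@fps_addA R) (@fps_addC R) (@fps_add0 R) (@fps_addN R).

Definition fps_trunc (R : comNzRingType) (N : nat) (a : {fps R}) : {poly R} :=
  \poly_(i < N.+1) a i.

Lemma coef_fps_trunc (R : comNzRingType) (N i : nat) (a : {fps R}) :
  (i <= N)%N -> (fps_trunc N a)`_i = a i.
Proof. by move=> le_iN; rewrite coef_poly ltnS le_iN. Qed.

Lemma fps_mul_trunc (R : comNzRingType) (N i : nat) (a b : {fps R}) :
  (i <= N)%N -> fps_mul a b i = (fps_trunc N a * fps_trunc N b)`_i.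
Proof.
move=> le_iN; rewrite coefM; apply: eq_bigr => -[j /= lt_ji] _.
rewrite !coef_fps_trunc //; first exact: leq_trans (leq_subr _ _) le_iN.
exact: leq_trans (ltnSE lt_ji) le_iN.
Qed.

Lemma fps_mulC (R : comNzRingType) : commutative (@fps_mul R).
Proof.
by move=> a b; apply: fpsP => n; rewrite !(fps_mul_trunc (N := n)) // mulrC.
Qed.

Lemma fps_mulA (R : comNzRingType) : associative (@fps_mul R).
Proof.
have mulE (u v : {fps R}) n : fps_mul u v n = \sum_(j < n.+1) u j * v (n - j)%N.
  by [].
move=> a b c; apply: fpsP => n.
transitivity ((fps_trunc n a * (fps_trunc n b * fps_trunc n c))`_n).
  rewrite mulE coefM; apply: eq_bigr => j _.
  by rewrite (fps_mul_trunc (N := n)) ?leq_subr // coef_fps_trunc ?leq_ord.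
rewrite mulE mulrA coefM; apply: eq_bigr => j _.
by rewrite (fps_mul_trunc (N := n)) ?leq_ord // coef_fps_trunc ?leq_subr.
Qed.

Lemma fps_mul1 (R : comNzRingType) : left_id (@fps_one R) (@fps_mul R).
Proof.
move=> a; apply: fpsP => n /=; rewrite big_ord_recl subn0 mul1r big1 ?addr0 //.
by move=> i _; rewrite mul0r.
Qed.

Lemma fps_mulDl (R : comNzRingType) :
  left_distributive (@fps_mul R) (@fps_add R).
Proof.
move=> a b c; apply: fpsP => n /=; rewrite -big_split /=.
by apply: eq_bigr => i _; rewrite mulrDl.
Qed.

Lemma fps_one_neq0 (R : comNzRingType) : fps_one R != 0.
Proof.
apply/eqP => /(congr1 (fun a : {fps R} => a 0%N)) /= /eqP.
by rewrite oner_eq0.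
Qed.

HB.instance Definition _ (R : comNzRingType) :=
  GRing.Zmodule_isComNzRing.Build {fps R}
    (@fps_mulA R) (@fps_mulC R) (@fps_mul1 R) (@fps_mulDl R) (@fps_one_neq0 R).

(* [fps_comp g a] is g(a(x)) = \sum_k g_k a(x)^k. It is only meaningful when
   a has zero constant term: then a(x)^k has no monomial of degree < k, so the
   coefficient of degree n only involves the terms k <= n (see
   [fps_comp_stable]). *)
Definition fps_comp (R : comNzRingType) (g a : {fps R}) : {fps R} :=
  Fps (fun n => \sum_(k < n.+1) g k * (a ^+ k) n).

Lemma fps_exp_lt (R : comNzRingType) (a : {fps R}) (k n : nat) :
  a 0%N = 0 -> (n < k)%N -> (a ^+ k) n = 0.
Proof.
move=> a0; elim: k n => // k IHk n lt_nk; rewrite exprS.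
rewrite [LHS]/= big_ord_recl a0 mul0r add0r big1 // => i _.
rewrite IHk ?mulr0 // lift0; case: n lt_nk i => [|n] lt_nk i; first by case: i.
by rewrite subSS (leq_ltn_trans (leq_subr _ _)).
Qed.

Lemma fps_comp_stable (R : comNzRingType) (g a : {fps R}) (n N : nat) :
  a 0%N = 0 -> (n <= N)%N ->
  fps_comp g a n = \sum_(k < N.+1) g k * (a ^+ k) n.
Proof.
move=> a0 le_nN; rewrite /= (big_ord_widen N.+1 (fun k => g k * (a ^+ k) n)) //.
rewrite big_mkcond; apply: eq_bigr => k _; case: ltnP => // lt_nk.
by rewrite fps_exp_lt ?mulr0.
Qed.

(* Main.v *)
(** If [d = a - b] has order at least [m], then the factorization
    [a^k - b^k = d * \sum_(i < k) a^(k-1-i) * b^i] shows that [a^k - b^k] has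
    order at least [m + (k-1) s], with coefficient [d_m * k * a_s^(k-1)] there.
    Hence the coefficient of degree [m + (r-1) s] of [g(a) - g(b)] is
    [g_r * d_m * r * a_s^(r-1)]: the terms with [k > r] start later. In
    characteristic zero this forces [d_m = 0], and [d = 0] by induction on
    [m]. *)
Require Import Defs.
From mathcomp Require Import all_boot all_algebra.
Set Implicit Arguments.
Import GRing.Theory.
Local Open Scope ring_scope.

(** A lower bound on the order rather than the order itself: the zero series then needs no special
    case. *)
Definition fps_order_ge (R : comNzRingType) (p : nat) (a : {fps R}) : Prop :=
  forall i, (i < p)%N -> a i = 0.

Lemma fps_coefB (R : comNzRingType) (a b : {fps R}) n : (a - b) n = a n - b n.
Proof. by []. Qed.

Lemma fps_coef_sum (R : comNzRingType) (k : nat) (f : 'I_k -> {fps R}) n :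
  (\sum_(i < k) f i) n = \sum_(i < k) f i n.
Proof. by apply: (big_morph (fun a : {fps R} => a n)). Qed.

Lemma fps_order_ge_mul (R : comNzRingType) (p q : nat) (a b : {fps R}) :
  fps_order_ge p a -> fps_order_ge q b -> fps_order_ge (p + q) (a * b).
Proof.
move=> a_p b_q n lt_n; rewrite [LHS]/= big1 // => j _.
have [/a_p ->|le_pj] := ltnP j p; first by rewrite mul0r.
rewrite b_q ?mulr0 // ltn_subLR ?leq_ord //.
by rewrite (leq_trans lt_n) // leq_add2r.
Qed.

(** In the convolution at degree [p + q], an index [j] other than [p] has [j < p] or
    [p + q - j < q], so a single product survives. *)
Lemma fps_mul_lead (R : comNzRingType) (p q : nat) (a b : {fps R}) :
  fps_order_ge p a -> fps_order_ge q b -> (a * b) (p + q)%N = a p * b q.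
Proof.
move=> a_p b_q; have lt_p : (p < (p + q).+1)%N by rewrite ltnS leq_addr.
rewrite [LHS]/= (bigD1 (Ordinal lt_p)) //= addKn big1 ?addr0 // => j.
rewrite -val_eqE /= neq_ltn => /orP[/a_p ->|lt_pj]; first by rewrite mul0r.
by rewrite b_q ?mulr0 // ltn_subLR ?leq_ord // ltn_add2r.
Qed.

Lemma fps_order_ge_exp (R : comNzRingType) (s k : nat) (a : {fps R}) :
  fps_order_ge s a -> fps_order_ge (k * s) (a ^+ k).
Proof.
by move=> a_s; elim: k => // k IHk; rewrite exprS mulSn; apply: fps_order_ge_mul.
Qed.

Lemma fps_exp_lead (R : comNzRingType) (s k : nat) (a : {fps R}) :
  fps_order_ge s a -> (a ^+ k) (k * s)%N = a s ^+ k.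
Proof.
move=> a_s; elim: k => // k IHk; rewrite exprS mulSn fps_mul_lead ?IHk ?exprS //.
exact: fps_order_ge_exp.
Qed.

Section PowerDifference.

Variables (R : comNzRingType) (s m : nat) (a b : {fps R}).
Hypotheses (a_s : fps_order_ge s a) (b_s : fps_order_ge s b).
Hypothesis ab_m : fps_order_ge m (a - b).

Lemma fps_order_ge_expM (k : nat) (i : 'I_k.+1) :
  fps_order_ge (k * s) (a ^+ (k - i) * b ^+ i).
Proof.
rewrite -{1}(subnK (leq_ord i)) mulnDl.
by apply: fps_order_ge_mul; apply: fps_order_ge_exp.
Qed.

Lemma fps_order_ge_geom (k : nat) :
  fps_order_ge (k * s) (\sum_(i < k.+1) a ^+ (k - i) * b ^+ i).
Proof.
move=> n lt_n; rewrite fps_coef_sum big1 // => i _.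
exact: fps_order_ge_expM lt_n.
Qed.

Lemma fps_order_ge_subX (k : nat) :
  fps_order_ge (m + k * s) (a ^+ k.+1 - b ^+ k.+1).
Proof.
rewrite subrXX; apply: fps_order_ge_mul => //; exact: fps_order_ge_geom.
Qed.

Lemma fps_subX_lead (k : nat) : a s = b s ->
  (a ^+ k.+1 - b ^+ k.+1) (m + k * s)%N = (a - b) m * (b s ^+ k *+ k.+1).
Proof.
move=> eq_s; rewrite subrXX fps_mul_lead //; last exact: fps_order_ge_geom.
congr (_ * _); rewrite fps_coef_sum -[k.+1 in RHS]card_ord -sumr_const.
apply: eq_bigr => -[i lt_ik] _; have le_ik := ltnSE lt_ik.
(* Splitting [k * s] as [(k - i) * s + i * s] shows that each of the [k.+1] summands contributes the
   same [b s ^+ k]. *)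
rewrite -[in (k * s)%N](subnK le_ik) mulnDl fps_mul_lead.
- by rewrite !fps_exp_lead // eq_s -exprD subnK.
- exact: fps_order_ge_exp.
- exact: fps_order_ge_exp.
Qed.

End PowerDifference.

Theorem theorem2p5 (F : fieldType) (charF0 : [pchar F] =i pred0)
    (g : {fps F}) (r : nat) (r_ge1 : (1 <= r)%N)
    (g_gap : forall i : nat, (0 < i < r)%N -> g i = 0) (gr_neq0 : g r != 0)
    (a b : {fps F}) (s : nat) (s_ge1 : (1 <= s)%N)
    (a_low : forall i : nat, (i < s)%N -> a i = 0)
    (b_low : forall i : nat, (i < s)%N -> b i = 0)
    (as_eq_bs : a s = b s) (bs_neq0 : b s != 0) :
  fps_comp g a = fps_comp g b -> a = b.
Proof.
move=> eq_comp; apply: fpsP => m; apply/eqP; rewrite -subr_eq0 -fps_coefB.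
have [n] := ubnP m; elim: n m => // n IHn m /ltnSE le_mn.
have ab_m : fps_order_ge m (a - b).
  by move=> i lt_im; apply/eqP/IHn/(leq_trans lt_im).
case: r r_ge1 g_gap gr_neq0 => // k _ g_gap gk_neq0.
(* Here [r] is [k.+1]. If [m = 0] and [s = 1], then [d = k], and the sum defining the composition at
   degree [d] stops before index [r]; the larger bound [N] always includes it. *)
set d := (m + k * s)%N; pose N := (d + k.+1)%N.
have le_dN : (d <= N)%N by rewrite leq_addr.
have lt_kN : (k.+1 < N.+1)%N by rewrite ltnS leq_addl.
have := congr1 (fun u : {fps F} => u d) eq_comp.
rewrite !(fps_comp_stable _ _ le_dN) ?a_low ?b_low //.
move/eqP; rewrite -subr_eq0 -sumrB.
under eq_bigr do rewrite -mulrBr -fps_coefB.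
(* Only index [r] survives: index 0 gives [1 - 1], indices strictly between 0 and [r] fall in the
   gap of [g], and for larger ones the order exceeds [d] because [s] is positive. *)
rewrite (bigD1 (Ordinal lt_kN)) // big1 ?Monoid.mulm1 => [|[[|j] lt_jN]].
- rewrite (fps_subX_lead a_low b_low ab_m) // !mulf_eq0 (negPf gk_neq0).
  rewrite -mulr_natr mulf_eq0 expf_eq0 (negPf bs_neq0) andbF.
  (* Characteristic zero excludes the last factor, [k.+1] seen in [F]. *)
  by rewrite ((pcharf0P F).1 charF0) orbF.
- by rewrite !expr0 subrr mulr0.
rewrite -val_eqE neq_ltn => /orP[lt_jk|]; first by rewrite g_gap ?mul0r.
rewrite ltnS => lt_kj; rewrite (fps_order_ge_subX a_low b_low ab_m) ?mulr0 //.
by rewrite ltn_add2l ltn_mul2r s_ge1.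
Qed.
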